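(* Let $G$ be an infinite planar group satisfying the ascending and descending chain conditions on subgroups. Then $G$ has no element of order $pqr$ for distinct primes $p,q,r$.
   Context: For a group $G$, the subgroup graph $\mathcal{L}(G)$ is the graph whose vertices are all subgroups of $G$, two subgroups $H,K$ being adjacent if one of them is a maximal subgroup of the other. $G$ is planar if $\mathcal{L}(G)$ is a planar graph. *)

(* Defs.v *)
From HB Require Import structures.
From mathcomp Require Import all_boot all_order all_algebra.
From mathcomp Require Import all_classical all_reals all_analysis.
From mathcomp Require Import Rstruct Rstruct_topology.
Set Implicit Arguments. Unset Strict Implicit. Unset Printing Implicit Defensive.
Import Order.TTheory GRing.Theory Num.Theory.

Record is_group (T : Type) (mul : T -> T -> T) (one : T) (inv : T -> T) : Prop := {
  grp_assoc : forall x y z, mul x (mul y z) = mul (mul x y) z;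
  grp_mul1 : forall x, mul one x = x;
  grp_mulV : forall x, mul (inv x) x = one }.

Fixpoint gpow (T : Type) (mul : T -> T -> T) (one : T) (x : T) (n : nat) : T :=
  match n with 0 => one | n'.+1 => mul x (gpow mul one x n') end.

Definition has_order (T : Type) (mul : T -> T -> T) (one : T) (x : T) (n : nat) : Prop :=
  (0 < n)%N /\ gpow mul one x n = one /\
  forall k, (0 < k)%N -> (k < n)%N -> gpow mul one x k <> one.

Definition is_subgroup (T : Type) (mul : T -> T -> T) (one : T) (inv : T -> T)
  (H : T -> Prop) : Prop :=
  H one /\ (forall x y, H x -> H y -> H (mul x y)) /\ (forall x, H x -> H (inv x)).

Definition subgrp (T : Type) (mul : T -> T -> T) (one : T) (inv : T -> T) : Type :=
  {H : T -> Prop | is_subgroup mul one inv H}.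

Definition sg_le (T : Type) (mul : T -> T -> T) (one : T) (inv : T -> T)
  (H K : subgrp mul one inv) : Prop := forall x, proj1_sig H x -> proj1_sig K x.

Definition infinite_type (T : Type) : Prop := ~ exists s : list T, forall x, List.In x s.

Definition subgroup_ACC (T : Type) (mul : T -> T -> T) (one : T) (inv : T -> T) : Prop :=
  forall Hs : nat -> subgrp mul one inv,
    (forall n, sg_le (Hs n) (Hs n.+1)) -> exists N, forall n, (N <= n)%N -> Hs n = Hs N.

Definition subgroup_DCC (T : Type) (mul : T -> T -> T) (one : T) (inv : T -> T) : Prop :=
  forall Hs : nat -> subgrp mul one inv,
    (forall n, sg_le (Hs n.+1) (Hs n)) -> exists N, forall n, (N <= n)%N -> Hs n = Hs N.

Definition sg_maximal (T : Type) (mul : T -> T -> T) (one : T) (inv : T -> T)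
  (H K : subgrp mul one inv) : Prop :=
  sg_le H K /\ H <> K /\
  forall L : subgrp mul one inv, sg_le H L -> sg_le L K -> L = H \/ L = K.

Definition subgroup_graph_adj (T : Type) (mul : T -> T -> T) (one : T) (inv : T -> T)
  (H K : subgrp mul one inv) : Prop :=
  sg_maximal H K \/ sg_maximal K H.

Local Open Scope ring_scope.
Notation R := Rdefinitions.R.
Notation plane := (R * R)%type.

Definition planar_graph (V : Type) (adj : V -> V -> Prop) : Prop :=
  exists (pos : V -> plane) (arc : V -> V -> R -> plane),
    (forall u v, pos u = pos v -> u = v) /\
    (forall u v, adj u v ->
       {within `[0, 1], continuous (arc u v)}%classic /\
       {in `[0, 1]%classic &, injective (arc u v)} /\
       arc u v 0 = pos u /\ arc u v 1 = pos v /\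
       (forall t w, 0 < t < 1 -> arc u v t <> pos w)) /\
    (forall u v u' v' t t', adj u v -> adj u' v' ->
       ~ ((u = u' /\ v = v') \/ (u = v' /\ v = u')) ->
       0 < t < 1 -> 0 < t' < 1 -> arc u v t <> arc u' v' t').

Definition planar_group (T : Type) (mul : T -> T -> T) (one : T) (inv : T -> T) : Prop :=
  planar_graph (@subgroup_graph_adj T mul one inv).

(* Main.v *)
Require Import Defs.
From HB Require Import structures.
From mathcomp Require Import all_boot.
From mathcomp Require Import all_order all_algebra.
From mathcomp Require Import all_classical all_reals all_analysis.
From mathcomp Require Import Rstruct Rstruct_topology.
From mathcomp Require Import lra.
From Stdlib Require Import Ring.
Set Implicit Arguments. Unset Strict Implicit. Unset Printing Implicit Defensive.
Import Order.TTheory GRing.Theory Num.Theory.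
Import numFieldNormedType.Exports.

(* Let x have order pqr. The subgroups of <x> form a cube in the subgroup graph, and the
   descending chain condition makes G a torsion group.
   If some y of prime order lies outside <x>, then maximal chains from 1 through <y> up to G
   and down to <x> join two antipodal vertices of the cube outside the cube, which
   gives a subdivided K_{3,3}.
   Otherwise all elements of prime order lie in <x>; hence <x> is normal and its centralizer
   F has finite index, so F is infinite. If two p-elements of F generate incomparable
   cyclic groups, there are p-elements a, b of F with <a^p> = <b^p> and a, b incomparable,
   and the subgroups of <a x^p> and <b x^p> contain a subdivided K_{3,3}. So the
   p-elements of F form a single cyclic group, finite by torsion; likewise for q and r,
   and F, consisting of products of such elements, is finite.
   A K_{3,3} is not planar because the crossings of independent edges, counted mod 2 by
   winding numbers, are odd in number. *)

(** * Nonplanarity of K_{3,3} *)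

Section Crossing.
Local Open Scope ring_scope.
Local Open Scope classical_set_scope.
Variables (K : realType) (e : K).
Implicit Types (u v w x y a b c d : K * K) (s t : seq (K * K)).

Definition eclose x y := (`|x.1 - y.1| < e) && (`|x.2 - y.2| < e).
(** The bound is twice [e] because [x - y] moves by less than that in each coordinate when [x] and
    [y] both make a step below [e]. *)
Definition far u := (e *+ 2 <= `|u.1|) || (e *+ 2 <= `|u.2|).

(* The half-open upper half-plane: it contains exactly one of u, - u when u != 0. *)
Definition upper u := (0 < u.2) || ((u.2 == 0) && (0 < u.1)).

(* Whether a short step from u to v crosses the negative horizontal axis. *)
Definition cross u v := (upper u (+) upper v) && (u.1 < 0).

(** Crossings of the leftward ray from [v], mod 2: for a closed chain of short steps far from [v],
    the parity of its winding number around [v]. The rightward ray is counted by [cowinding]. *)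
Fixpoint winding v a s :=
  if s is b :: s' then cross (a - v) (b - v) (+) winding v b s' else false.

Fixpoint cowinding v a s :=
  if s is b :: s' then cross (v - a) (v - b) (+) cowinding v b s' else false.

Lemma far_upperN u : 0 < e -> far u -> upper (- u) = ~~ upper u.
Proof.
case: u => u1 u2 e0; rewrite /far /upper /= oppr_gt0 oppr_eq0 oppr_gt0.
by case: (ltrgt0P u2) => // h2 /orP[]; case: (ltrgt0P u1) => // h1; rewrite ?h2 ?h1; lra.
Qed.

(** A step that changes [upper] stays on one side of the vertical axis, so the half-axis it crosses
    is unambiguous. *)
Definition sector u v := upper u != upper v -> (u.1 < 0) = (v.1 < 0) /\ u.1 != 0.

(** If [upper] changes, both second coordinates are below [2e] in absolute value. Then both first
    coordinates are at least [2e], and a step below [2e] cannot reverse their sign. *)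
Lemma far_sector u v : far u -> far v ->
  `|u.1 - v.1| < e *+ 2 -> `|u.2 - v.2| < e *+ 2 -> sector u v.
Proof.
case: u v => [u1 u2] [v1 v2]; rewrite /far /sector /upper /=.
move=> fu fv d1 d2 h.
have [s2 t2] : `|u2| < e *+ 2 /\ `|v2| < e *+ 2.
  move: h d2; rewrite !ltr_norml.
  by case: (ltrgt0P u2) => // h2; case: (ltrgt0P v2) => // k2 /=; rewrite ?h2 ?k2; lra.
have f1 : e *+ 2 <= `|u1| by case/orP: fu => //; lra.
have f2 : e *+ 2 <= `|v1| by case/orP: fv => //; lra.
move: f1 f2 d1; rewrite !ltr_norml.
by case: (ltrgt0P u1) => // h1; case: (ltrgt0P v1) => // k1 /=; rewrite ?h1 ?k1; lra.
Qed.

Lemma farN u : far (- u) = far u.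
Proof. by rewrite /far /= !normrN. Qed.

(** If [upper] is not constant on the corners, comparing the corners of its two classes puts all
    four on one side of the vertical axis. So either no change of [upper] counts or all do, and a
    closed loop has an even number of them. *)
Lemma cross_cell u00 u10 u01 u11 :
  sector u00 u10 -> sector u00 u01 -> sector u00 u11 -> sector u10 u01 ->
  sector u10 u11 -> sector u01 u11 ->
  cross u00 u10 (+) cross u01 u11 (+) (cross u00 u01 (+) cross u10 u11) = false.
Proof.
rewrite /sector /cross.
case: (upper u00); case: (upper u10); case: (upper u01); case: (upper u11) => //=;
do 6?[move=> /(_ isT)[-> _] || move=> _]; do ?case: (_ < _) => //.
Qed.

Lemma crossN u v : 0 < e -> far u -> far v -> sector u v ->
  cross u v (+) cross (- u) (- v) = upper u (+) upper v.
Proof.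
move=> e0 fu fv; rewrite /sector /cross !far_upperN //= oppr_lt0.
case: (upper u); case: (upper v) => //= /(_ isT)[_]; rewrite neq_lt;
 by case: (ltrgt0P u.1).
Qed.

Lemma cell_false a b c d : eclose a b -> eclose c d ->
  far (a - c) -> far (b - c) -> far (a - d) -> far (b - d) ->
  cross (a - c) (b - c) (+) cross (a - d) (b - d)
    (+) (cross (a - c) (a - d) (+) cross (b - c) (b - d)) = false.
Proof.
move=> /andP[ab1 ab2] /andP[cd1 cd2] f1 f2 f3 f4.
move: ab1 ab2 cd1 cd2; rewrite !ltr_norml => ab1 ab2 cd1 cd2.
apply: cross_cell; apply: far_sector => //=; rewrite ltr_norml; lra.
Qed.

Lemma strip_false a b c t : eclose a b -> path eclose c t ->
  {in c :: t, forall y, far (a - y) /\ far (b - y)} ->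
  cross (a - c) (b - c) (+) cross (a - last c t) (b - last c t)
    (+) (cowinding a c t (+) cowinding b c t) = false.
Proof.
move=> ab; elim: t c => [|d t IH] c /=; first by rewrite addbb.
move=> /andP[cd dt] h.
have [fac fbc] := h c (mem_head _ _).
have [fad fbd] : far (a - d) /\ far (b - d) by apply: h; rewrite !inE eqxx orbT.
have := cell_false ab cd fac fbc fad fbd.
have := IH d dt; case: (cowinding a d t); case: (cowinding b d t);
  case: (cross _ _); case: (cross _ _); case: (cross _ _); case: (cross _ _);
  case: (cross _ _) => //= -> // y yt; apply: h; rewrite inE yt orbT //.
Qed.

(** Summing over the cells of the grid [s] by [t], one strip at a time, the inner edges cancel and
    the boundary remains. *)
Lemma grid_false a s c t : path eclose a s -> path eclose c t ->
  {in a :: s & c :: t, forall x y, far (x - y)} ->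
  winding c a s (+) winding (last c t) a s
    (+) (cowinding a c t (+) cowinding (last a s) c t) = false.
Proof.
move=> + ct; elim: s a => [|b s IH] a /=; first by rewrite addbb.
move=> /andP[ab bs] h.
have hab : {in c :: t, forall y, far (a - y) /\ far (b - y)}.
  by move=> y yt; split; apply: h => //; rewrite !inE eqxx ?orbT.
have := strip_false ab ct hab.
have hb : {in b :: s & c :: t, forall x y, far (x - y)}.
  by move=> x y xs; apply: h; rewrite inE xs orbT.
have := IH b bs hb.
set w1 := cowinding _ _ _; set w2 := cowinding _ _ _; set w3 := cowinding _ _ _.
by case: (winding _ _ _); case: (winding _ _ _); case: (cross _ _);
  case: (cross _ _); case: w1; case: w2; case: w3.
Qed.

(** A step that changes [upper] crosses exactly one of the two opposite rays, by [crossN], and the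
    changes of [upper] telescope. *)
Lemma winding_cowinding v a s : 0 < e -> path eclose a s ->
  {in a :: s, forall x, far (x - v)} ->
  winding v a s (+) cowinding v a s = upper (a - v) (+) upper (last a s - v).
Proof.
move=> e0; elim: s a => [|b s IH] a /=; first by rewrite addbb.
move=> /andP[/andP[ab1 ab2] bs] h.
have fa : far (a - v) by apply: h; rewrite inE eqxx.
have fb : far (b - v) by apply: h; rewrite !inE eqxx orbT.
have sab : sector (a - v) (b - v).
  move: ab1 ab2; rewrite !ltr_norml => ab1 ab2.
  by apply: far_sector => //=; rewrite ltr_norml; lra.
have hb : {in b :: s, forall x, far (x - v)}.
  by move=> x xs; apply: h; rewrite inE xs orbT.
have := IH b bs hb; have := crossN e0 fa fb sab; rewrite !opprB.
case: (winding _ _ _); case: (cowinding _ _ _); case: (upper _); case: (upper _);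
  case: (upper _); case: (cross _ _); case: (cross _ _) => //.
Qed.

(* When x runs from a to b and y from c to d, the direction x - y maps a square to the
   punctured plane, so its winding around the boundary vanishes. *)
Lemma winding_sum a b s c d t : 0 < e -> last a s = b -> last c t = d ->
  path eclose a s -> path eclose c t ->
  {in a :: s & c :: t, forall x y, far (x - y)} ->
  winding c a s (+) winding d a s (+) (winding a c t (+) winding b c t)
   (+) (upper (c - a) (+) upper (d - a) (+) (upper (c - b) (+) upper (d - b))) = false.
Proof.
move=> e0 <- <- ps pt h.
have ha : {in c :: t, forall y, far (y - a)}.
  by move=> y yt; rewrite -opprB farN; apply: h => //; rewrite mem_head.
have hb : {in c :: t, forall y, far (y - last a s)}.
  by move=> y yt; rewrite -opprB farN; apply: h => //; rewrite mem_last.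
rewrite -(winding_cowinding e0 pt ha) -(winding_cowinding e0 pt hb).
rewrite -(grid_false ps pt h).
set w1 := winding _ _ _; set w2 := winding _ _ _; set w3 := winding _ _ _.
set w4 := winding _ _ _; set w5 := cowinding _ _ _; set w6 := cowinding _ _ _.
by case: w1; case: w2; case: w3; case: w4; case: w5; case: w6.
Qed.
End Crossing.

(** * Chains in connected sets and distances between compact sets *)

Section Continua.
Local Open Scope ring_scope.
Local Open Scope classical_set_scope.
Variable K : realType.
Implicit Types S : set (K * K).

Lemma ecloseE (e : K) (x y : K * K) : eclose e x y = (ball x e y) :> Prop.
Proof.
rewrite /eclose; apply/propext; split.
  by move=> /andP[h1 h2]; split.
by move=> [h1 h2]; apply/andP; split.
Qed.

(** The points reachable from [a] by [e]-chains in [S] form a nonempty, relatively open and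
    relatively closed subset. *)
Lemma connected_chain S a b (e : K) : 0 < e -> connected S -> S a -> S b ->
  exists s, [/\ path (eclose e) a s, last a s = b & forall x, x \in a :: s -> S x].
Proof.
move=> e0 cS Sa Sb.
pose B := [set y | S y /\
  exists s, [/\ path (eclose e) a s, last a s = y & forall x, x \in a :: s -> S x]].
have step x y : B x -> S y -> eclose e x y -> B y.
  move=> [Sx [s [ps ls hs]]] Sy xy; split=> //; exists (rcons s y).
  rewrite rcons_path ps ls last_rcons; split=> //.
  by move=> z; rewrite -rcons_cons mem_rcons inE => /predU1P[->//|/hs].
have closeC x y : eclose e x y = eclose e y x by rewrite /eclose !(distrC x.1, distrC x.2).
have openU (C : set (K * K)) : open (\bigcup_(y in C) ball y e).
  apply: bigcup_open => y _; exact: ball_open.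
suff BS : B = S by have [] : B b by rewrite BS.
apply: cS.
- exists a; split=> //; exists [::]; split=> // x; rewrite inE => /eqP->//.
- exists (\bigcup_(y in B) ball y e) => //.
  apply/seteqP; split=> y.
    by move=> By; split; [case: By|exists y => //; exact: ballxx].
  move=> [Sy [x Bx]]; rewrite -ecloseE => xy; exact: step xy.
- exists (~` \bigcup_(y in S `\` B) ball y e); first exact: open_closedC.
  apply/seteqP; split=> y.
    move=> By; split; [by case: By|case=> x [Sx nBx]].
    by rewrite -ecloseE closeC => /(step _ _ By Sx).
  move=> [Sy h]; apply: contrapT => nBy; apply: h; exists y => //; exact: ballxx.
Qed.

Lemma compact_far S S' : compact S -> compact S' -> S `&` S' = set0 ->
  exists2 e : K, 0 < e & forall x y, S x -> S' y -> far e (x - y).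
Proof.
move=> cS cS' SS'.
pose f (z : (K * K) * (K * K)) : K := `|z.1 - z.2|.
have cf : continuous f.
  move=> z; apply: (@cvg_comp _ _ _ (fun z : (K*K)*(K*K) => z.1 - z.2) (fun u : K * K => `|u|)).
    by apply: cvgB; [exact: cvg_fst|exact: cvg_snd].
  exact: norm_continuous.
have cfS : compact (f @` (S `*` S')).
  apply: continuous_compact; last exact: compact_setX.
  exact: continuous_subspaceT.
have : (~` (f @` (S `*` S'))) 0.
  move=> [[x y] [/= Sx Sy]] /eqP; rewrite normr_eq0 subr_eq0 => /eqP /= xy.
  suff : (S `&` S') x by rewrite SS'.
  by split=> //; rewrite xy.
have /closed_openC : closed (f @` (S `*` S')) by apply: compact_closed.
rewrite openE => /[apply]; rewrite /interior /= -nbhs_ballE => -[d /= d0 hd].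
(* Halved because [far] doubles its parameter. *)
exists (d / 2); first by rewrite divr_gt0.
move=> x y Sx Sy; rewrite /far mulr2n -splitr.
apply: contraT; rewrite negb_or -!ltNge => /andP[h1 h2].
case: (hd `|x - y|).
  by rewrite /ball /= sub0r normrN normr_id prod_normE gt_max h1 h2.
by exists (x, y).
Qed.
End Continua.

(** * The parity contradiction for drawings of K_{3,3} *)

Section Nonplanarity.
Local Open Scope ring_scope.
Local Open Scope classical_set_scope.

(* The first hypothesis is winding_sum for the edges (i, k) and (j, l): nA j i k and nB l i k
   are the windings of the edge (i, k) around the vertices a_j and b_l, and uA, uAB, uBA, uB record
   which differences of vertices are upper. *)
Lemma K33_parity (nA nB : 'I_3 -> 'I_3 -> 'I_3 -> bool)
    (uA uAB uBA uB : 'I_3 -> 'I_3 -> bool) :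
  (forall i j k l, i != j -> k != l ->
    nA j i k (+) nB l i k (+) (nA i j l (+) nB k j l)
      (+) (uA i j (+) uAB i l (+) (uBA k j (+) uB k l)) = false) ->
  (forall k l, k != l -> uB l k = ~~ uB k l) -> False.
Proof.
pose o0 : 'I_3 := @Ordinal 3 0 isT; pose o1 : 'I_3 := @Ordinal 3 1 isT.
pose o2 : 'I_3 := @Ordinal 3 2 isT.
move=> E U.
have addE b c : b (+) c = xorb b c by case: b; case: c.
have addf x y : x = false -> y = false -> xorb x y = false by move=> -> ->.
(* In the sum of [E i j k l] over the ordered pairs [k != l], each term in [nA], [uA], [uAB], [uBA]
   occurs an even number of times. The [nB] terms give [sB i] and [sB j], and the three pairs of
   opposite [uB] values give 1. But three bits cannot be pairwise different. *)
pose sB i := xorb (nB o0 i o1) (xorb (nB o0 i o2) (xorb (nB o1 i o0)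
  (xorb (nB o1 i o2) (xorb (nB o2 i o0) (nB o2 i o1))))).
have pair i j : i != j -> xorb (sB i) (sB j) = true.
  move=> ij.
  have := E i j o0 o1 ij isT; have := E i j o0 o2 ij isT.
  have := E i j o1 o0 ij isT; have := E i j o1 o2 ij isT.
  have := E i j o2 o0 ij isT; have := E i j o2 o1 ij isT.
  have := U o0 o1 isT; have := U o0 o2 isT; have := U o1 o2 isT.
  rewrite -!addTb !addE => -> -> -> e1 e2 e3 e4 e5 e6.
  rewrite -[RHS]/(xorb true false).
  rewrite -(addf _ _ (addf _ _ (addf _ _ e1 e2) (addf _ _ e3 e4)) (addf _ _ e5 e6)) /sB.
  ring.
have := pair o0 o1 isT; have := pair o0 o2 isT; have := pair o1 o2 isT.
by case: (sB o0); case: (sB o1); case: (sB o2).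
Qed.

Lemma far_le (K : realType) (e e' : K) u : e' <= e -> far e u -> far e' u.
Proof.
by rewrite /far => h /orP[] h'; apply/orP; [left|right];
  rewrite (le_trans _ h')// lerMn2r h orbT.
Qed.

Lemma uniform_finite (K : realType) (I : finType) (P : K -> I -> Prop) :
  (forall e e' i, e' <= e -> P e i -> P e' i) ->
  (forall i, exists2 e, 0 < e & P e i) -> exists2 e, 0 < e & forall i, P e i.
Proof.
move=> mP h.
suff [e e0 he] : exists2 e, 0 < e & forall i, i \in enum I -> P e i.
  by exists e => // i; apply: he; rewrite mem_enum.
elim: (enum I) => [|i s [e e0 he]]; first by exists 1.
have [e' e'0 he'] := h i; exists (Order.min e e'); first by rewrite lt_min e0.
move=> j; rewrite inE => /predU1P[->|/he pj].
  by apply: mP he'; rewrite ge_min lexx orbT.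
by apply: mP pj; rewrite ge_min lexx.
Qed.

(** The edges may be arbitrary continua, since only chains inside them enter the count; the step of
    these chains is small against all distances between independent edges. *)
Theorem K33_continua (K : realType) (a b : 'I_3 -> K * K) (S : 'I_3 -> 'I_3 -> set (K * K)) :
  (forall i k, [/\ compact (S i k), connected (S i k), S i k (a i) & S i k (b k)]) ->
  (forall i j k l, i != j -> k != l -> S i k `&` S j l = set0) -> False.
Proof.
move=> hS disj.
have [e e0 he] : exists2 e : K, 0 < e & forall t : ('I_3 * 'I_3) * ('I_3 * 'I_3),
    t.1.1 != t.1.2 -> t.2.1 != t.2.2 ->
    forall x y, S t.1.1 t.2.1 x -> S t.1.2 t.2.2 y -> far e (x - y).
  apply: (@uniform_finite K _ (fun e (t : ('I_3 * 'I_3) * ('I_3 * 'I_3)) =>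
    t.1.1 != t.1.2 -> t.2.1 != t.2.2 ->
    forall x y, S t.1.1 t.2.1 x -> S t.1.2 t.2.2 y -> far e (x - y))).
    by move=> e e' t ee' h h1 h2 x y Sx Sy; apply: (far_le ee'); exact: h.
  move=> [[i j] [k l]] /=.
  have [/eqP ij|ij] := boolP (i == j); first by exists 1.
  have [/eqP kl|kl] := boolP (k == l); first by exists 1.
  have [cik _ _ _] := hS i k; have [cjl _ _ _] := hS j l.
  have [e e0 he] := compact_far cik cjl (disj _ _ _ _ ij kl).
  by exists e.
have {}he i j k l : i != j -> k != l ->
    forall x y, S i k x -> S j l y -> far e (x - y).
  exact: (he ((i, j), (k, l))).
have /choice[w hw] : forall t : 'I_3 * 'I_3, exists s,
    [/\ path (eclose e) (a t.1) s, last (a t.1) s = b t.2 &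
        forall x, x \in a t.1 :: s -> S t.1 t.2 x].
  move=> [i k]; have [_ cS Sa Sb] := hS i k; exact: connected_chain.
apply: (@K33_parity (fun j i k => winding (a j) (a i) (w (i, k)))
  (fun l i k => winding (b l) (a i) (w (i, k)))
  (fun i j => upper (a j - a i)) (fun i l => upper (b l - a i))
  (fun k j => upper (a j - b k)) (fun k l => upper (b l - b k))) => /=.
  move=> i j k l ij kl.
  have [/= p1 l1 s1] := hw (i, k); have [/= p2 l2 s2] := hw (j, l).
  apply: (@winding_sum K e) => // x y xs ys.
  by apply: (he _ _ _ _ ij kl); [exact: s1|exact: s2].
move=> k l kl; rewrite -opprB; apply: (far_upperN e0).
(* The edges [(0, k)] and [(1, l)] are independent, so [b k] and [b l] are far apart and [upper]
   takes opposite values on their two differences. *)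
have o01 : @Ordinal 3 0 isT != @Ordinal 3 1 isT by [].
have [_ _ _ Sk] := hS (@Ordinal 3 0 isT) k.
have [_ _ _ Sl] := hS (@Ordinal 3 1 isT) l.
by rewrite -opprB farN; exact: (he _ _ _ _ o01 kl).
Qed.

(** * Walks in a drawn graph as plane continua *)

Section Walks.
Variables (V : Type) (adj : V -> V -> Prop).

Fixpoint walk (u : V) (s : seq V) : Prop :=
  if s is v :: s' then adj u v /\ walk v s' else True.

Lemma walk_cat u s t : walk u s -> walk (last u s) t -> walk u (s ++ t).
Proof. by elim: s u => [|v s IH] u //= [uv ws] wt; split=> //; exact: IH. Qed.

Variables (pos : V -> R * R) (arc : V -> V -> R -> R * R).

Fixpoint support u s : set (R * R) :=
  if s is v :: s' then arc u v @` `[0, 1] `|` support v s' else [set pos u].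

Hypothesis arcP : forall u v, adj u v ->
  {within `[0, 1], continuous (arc u v)} /\
  {in `[0, 1] &, injective (arc u v)} /\
  arc u v 0 = pos u /\ arc u v 1 = pos v /\
  (forall t w, 0 < t < 1 -> arc u v t <> pos w).

(** A walk may repeat vertices, so its support need not be an arc; being a continuum is enough for
    [K33_continua]. *)
Lemma supportP u s : walk u s ->
  [/\ compact (support u s), connected (support u s),
      support u s (pos u) & support u s (pos (last u s))].
Proof.
elim: s u => [|v s IH] u /=.
  by move=> _; split=> //; [exact: compact_set1|exact: connected1].
move=> [uv /IH[cpt conn hv hl]].
have [ct [_ [a0 [a1 _]]]] := arcP uv.
have c0 : (arc u v @` `[0, 1]) (pos u).
  by exists 0 => //=; rewrite in_itv /= lexx ler01.
have c1 : (arc u v @` `[0, 1]) (pos v).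
  by exists 1 => //=; rewrite in_itv /= lexx ler01.
split; [| |by left|by right].
- apply: compactU => //; apply: continuous_compact => //; exact: segment_compact.
- apply: connectedU => //; first by exists (pos v).
  apply: connected_continuous_connected => //; exact: segment_connected.
Qed.

Lemma support_inv u s x : walk u s -> support u s x ->
  (exists2 v, List.In v (u :: s) & x = pos v) \/
  exists v w t, [/\ adj v w, List.In v (u :: s), List.In w (u :: s), 0 < t < 1
    & x = arc v w t].
Proof.
elim: s u => [|v s IH] u /=.
  by move=> _ ->; left; exists u => //; left.
move=> [uv ws] [[t /=]|/(IH _ ws)]; last first.
  case=> [[w hw ->]|[w [z [t [wz hw hz t01 ->]]]]]; [left|right].
    by exists w => //; right.
  by exists w, z, t; split=> //; right.
rewrite in_itv /= => /andP[t0 t1] <-; have [_ [_ [a0 [a1 _]]]] := arcP uv.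
move: t0; rewrite le_eqVlt => /predU1P[<-|t0].
  by rewrite a0; left; exists u => //; left.
move: t1; rewrite le_eqVlt => /predU1P[->|t1].
  by rewrite a1; left; exists v => //; right; left.
right; exists u, v, t; split=> //; [by left|by right; left|by rewrite t0].
Qed.
End Walks.

(** Walks without a common vertex have disjoint supports: arcs of different edges have disjoint
    interiors, and no interior point of an arc is a vertex. *)
Theorem planar_no_K33 (V : Type) (adj : V -> V -> Prop) (a b : 'I_3 -> V)
    (w : 'I_3 -> 'I_3 -> seq V) : planar_graph adj ->
  (forall i k, walk adj (a i) (w i k) /\ last (a i) (w i k) = b k) ->
  (forall i j k l v, i != j -> k != l ->
    List.In v (a i :: w i k) -> List.In v (a j :: w j l) -> False) -> False.
Proof.
move=> [pos [arc [posI [arcP arcD]]]] hw disj.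
apply: (@K33_continua _ (pos \o a) (pos \o b) (fun i k => support pos arc (a i) (w i k))).
  by move=> i k /=; have [wik <-] := hw i k; exact: (supportP arcP wik).
move=> i j k l ij kl; apply/seteqP; split=> // x [].
have [wik _] := hw i k; have [wjl _] := hw j l.
have dj v v' : List.In v (a i :: w i k) -> List.In v' (a j :: w j l) -> v <> v'.
  by move=> h h' vv'; apply: (disj _ _ _ _ v ij kl h); rewrite vv'.
move=> /(support_inv arcP wik)[[v hv ->]|[v [v' [t [vv' hv hv' t01 ->]]]]].
  move=> /(support_inv arcP wjl)[[u hu /posI]|[u [u' [t [uu' hu hu' t01 /esym]]]]].
    exact: dj.
  by have [_ [_ [_ [_ h]]]] := arcP _ _ uu'; exact: h.
move=> /(support_inv arcP wjl)[[u hu]|[u [u' [t' [uu' hu hu' t01']]]]].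
  by have [_ [_ [_ [_ h]]]] := arcP _ _ vv'; exact: h.
apply: arcD => // -[] [e _]; by [exact: dj e|exact: dj e].
Qed.
End Nonplanarity.

(** * Subgroups and cyclic subgroups *)

Lemma well_founded_no_chain (T : Type) (r : T -> T -> Prop) :
  (forall f : nat -> T, ~ forall n, r (f n.+1) (f n)) -> well_founded r.
Proof.
move=> h x; apply: contrapT => nx.
have /choice[g hg] : forall y : {y | ~ Acc r y}, exists z : {y | ~ Acc r y},
    r (proj1_sig z) (proj1_sig y).
  move=> [y ny]; apply: contrapT => hn; apply: (ny); constructor => z zy.
  by apply: contrapT => nz; apply: hn; exists (exist _ z nz).
by apply: (h (fun n => proj1_sig (iter n g (exist _ x nx)))) => n; exact: hg.
Qed.

Lemma well_founded_min (T : Type) (r : T -> T -> Prop) (P : T -> Prop) :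
  well_founded r -> (exists x, P x) -> exists2 x, P x & forall y, r y x -> ~ P y.
Proof.
move=> wf [x]; elim: (wf x) => {}x _ IH Px.
have [[y [yx Py]]|h] := pselect (exists y, r y x /\ P y); first exact: IH Py.
by exists x => // y yx Py; apply: h; exists y.
Qed.

Section Subgroups.
Local Open Scope group_scope.
Variable G : groupType.
Notation sub := (subgrp ( *%g : G -> G -> G) 1 (fun x => x^-1)).
Notation "H ! x" := (proj1_sig H x) (at level 20).
Implicit Types (H K L : sub) (x y z u v : G).

Lemma sub1 H : H ! 1. Proof. by case: H => P []. Qed.
Lemma subM H x y : H ! x -> H ! y -> H ! (x * y).
Proof. by case: H => P [? []] /= h _; exact: h. Qed.
Lemma subV H x : H ! x -> H ! x^-1.
Proof. by case: H => P [? []] /= _ h; exact: h. Qed.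
Lemma subX H x n : H ! x -> H ! (x ^+ n).
Proof.
by move=> Hx; elim: n => [|n IH]; [rewrite expg0; exact: sub1|rewrite expgS; exact: subM].
Qed.

Lemma sub_ext H K : sg_le H K -> sg_le K H -> H = K.
Proof.
case: H K => [P hP] [Q hQ] PQ QP.
have e : P = Q by apply/funext => x; apply/propext; split; [exact: PQ|exact: QP].
by subst Q; congr exist; exact: Prop_irrelevance.
Qed.

Lemma sub_gcd H z m n : H ! (z ^+ m) -> H ! (z ^+ n) -> H ! (z ^+ gcdn m n).
Proof.
case: (posnP m) => [-> _|m0]; first by rewrite gcd0n.
case: (egcdnP n m0) => km kn e _ hm hn.
suff -> : z ^+ gcdn m n = (z ^+ n ^+ kn)^-1 * z ^+ m ^+ km.
  by apply: subM; [apply: subV|]; apply: subX.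
by rewrite -!expgnA (mulnC m) e expgnDr (mulnC n) mulKg.
Qed.

Lemma sub_coprime H z m n : coprime m n -> H ! (z ^+ m) -> H ! (z ^+ n) -> H ! z.
Proof. by move=> /eqP e hm hn; rewrite -(expg1 z) -e; exact: sub_gcd. Qed.

(** Taking <x> as the intersection of all subgroups through [x] avoids negative exponents; [cycP]
    recovers the natural powers for torsion elements. *)
Lemma cyc_subgroup x : is_subgroup ( *%g : G -> G -> G) 1 (fun x => x^-1)
  (fun y => forall H, H ! x -> H ! y).
Proof.
split; [by move=> H _; exact: sub1|split=> [y z hy hz H Hx|y hy H Hx]].
  by apply: subM; [exact: hy|exact: hz].
by apply: subV; exact: hy.
Qed.
Definition cyc x : sub := exist _ _ (cyc_subgroup x).

Lemma mem_cyc x : cyc x ! x. Proof. by []. Qed.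
Lemma cyc_le x H : H ! x -> sg_le (cyc x) H. Proof. by move=> Hx y; exact. Qed.
Lemma cycX x n : cyc x ! (x ^+ n). Proof. exact/subX/mem_cyc. Qed.
Lemma cyc_trans x y z : cyc y ! x -> cyc z ! y -> cyc z ! x.
Proof. by move=> xy yz; exact: (cyc_le yz). Qed.

Lemma cycX_mem x d e : e %| d -> cyc (x ^+ e) ! (x ^+ d).
Proof. by move=> /dvdnP[m ->]; rewrite mulnC expgnA; exact: cycX. Qed.

Definition torsion x := exists2 n, 0 < n & x ^+ n = 1.

Lemma cycP x y : torsion x -> cyc x ! y -> exists n, y = x ^+ n.
Proof.
move=> [n n0 xn].
have hS : is_subgroup ( *%g : G -> G -> G) 1 (fun x => x^-1) (fun y => exists n, y = x ^+ n).
  split; first by exists 0.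
  split=> [_ _ [a ->] [b ->]|_ [a ->]]; first by exists (a + b); rewrite expgnDr.
  exists (n.-1 * a)%N; apply: mulg1_eq.
  by rewrite -expgnDr -mulSn prednK// expgnA xn expg1n.
by move=> /(_ (exist _ _ hS)); apply; exists 1%N; rewrite expg1.
Qed.

Lemma torsionX x n : torsion x -> torsion (x ^+ n).
Proof. by move=> [m m0 xm]; exists m => //; rewrite expgnAC xm expg1n. Qed.

(** Says that [M] divides the order of [x], without an order function. *)
Definition order_mult M x := forall n, x ^+ n = 1 -> M %| n.

Lemma cycX_dvd M x d e : torsion x -> order_mult M x -> e %| M ->
  cyc (x ^+ e) ! (x ^+ d) -> e %| d.
Proof.
move=> tx oM eM /(cycP (torsionX e tx))[m xd].
have [n n0 xn] := tx.
(* Since [x ^+ n = 1], the exponent [n.-1 * m * e] serves as the negative of [m * e]. *)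
have : x ^+ (d + n.-1 * m * e)%N = 1.
  rewrite expgnDr xd -expgnA -expgnDr (mulnC e) -mulnA -mulSn prednK//.
  by rewrite expgnA xn expg1n.
move=> /oM/(dvdn_trans eM); rewrite dvdn_addl// dvdn_mull//.
Qed.

(** An element [x ^+ k] of [L] outside [cyc (x ^+ s)] has [k] prime to [s], so [L] contains [x] by
    Bezout. *)
Lemma cyc_maximal x s : torsion x -> prime s -> ~ cyc (x ^+ s) ! x ->
  sg_maximal (cyc (x ^+ s)) (cyc x).
Proof.
move=> tx ps nx; split; [exact/cyc_le/cycX|split=> [e|L hL Lx]].
  by apply: nx; rewrite e.
have [h|/existsNP[y /not_implyP[Ly ny]]] := pselect (sg_le L (cyc (x ^+ s))).
  by left; exact: sub_ext.
right; apply: sub_ext => //; apply: cyc_le.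
have [k e] := cycP tx (Lx _ Ly).
apply: (@sub_coprime _ _ s k); last by rewrite -e.
  rewrite prime_coprime//; apply/negP => /dvdnP[m km]; apply: ny.
  by rewrite e km mulnC expgnA; exact: cycX.
by apply: hL; exact: mem_cyc.
Qed.

Notation adj := (@subgroup_graph_adj G *%g 1 (fun x => x^-1)).

Lemma cyc_adj M x d s : torsion x -> order_mult M x -> prime s -> (d * s)%N %| M -> 0 < d ->
  adj (cyc (x ^+ d)) (cyc (x ^+ (d * s)%N)) /\ adj (cyc (x ^+ (d * s)%N)) (cyc (x ^+ d)).
Proof.
move=> tx oM ps dsM d0.
suff : sg_maximal (cyc (x ^+ (d * s)%N)) (cyc (x ^+ d)) by split; [right|left].
rewrite expgnA; apply: cyc_maximal => //; first exact: torsionX.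
rewrite -expgnA => /(cycX_dvd tx oM dsM).
by move=> /(dvdn_leq d0); rewrite leqNgt ltn_Pmulr// prime_gt1.
Qed.

(** * Consequences of the chain conditions *)

Section Chains.
Hypothesis acc : subgroup_ACC ( *%g : G -> G -> G) 1 (fun x => x^-1).
Hypothesis dcc : subgroup_DCC ( *%g : G -> G -> G) 1 (fun x => x^-1).

Definition sg_lt H K := sg_le H K /\ H <> K.

Lemma sg_lt_wf : well_founded sg_lt.
Proof.
apply: well_founded_no_chain => f hf.
have [N hN] := dcc (fun n => (hf n).1).
by have [_] := hf N; rewrite hN.
Qed.

Lemma sg_gt_wf : well_founded (fun H K => sg_lt K H).
Proof.
apply: well_founded_no_chain => f hf.
have [N hN] := acc (fun n => (hf n).1).
by have [_] := hf N; rewrite hN.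
Qed.

(** The ascending chain condition gives induction upwards from [H]; the descending one gives the
    next vertex, a minimal subgroup strictly above [H] inside [K]. *)
Lemma sub_walk H K : sg_le H K -> exists s,
  [/\ walk adj H s, last H s = K & forall L, List.In L (H :: s) -> sg_le H L].
Proof.
elim: (sg_gt_wf H) => {}H _ IH HK.
have [->|nHK] := pselect (H = K).
  by exists [::]; split=> // L [->|[]].
have [L [HL LK] minL] : exists2 L, sg_lt H L /\ sg_le L K &
    forall L', sg_lt L' L -> ~ (sg_lt H L' /\ sg_le L' K).
  by apply: (well_founded_min sg_lt_wf); exists K; split; [split|].
have [s [ws ls hs]] := IH L HL LK.
exists (L :: s); split=> //=.
  split=> //; left; split; [exact: HL.1|split; [exact: HL.2|]] => L' HL' L'L.
  have [|nH] := pselect (L' = H); first by left.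
  have [|nL] := pselect (L' = L); first by right.
  case: (minL L') => //; split=> //; first by split=> // e; apply: nH.
  by move=> x /L'L/LK.
by move=> L' [<-//|L'in] x /(HL.1); exact: (hs L').
Qed.

Lemma torsion_eq x a b : x ^+ a = x ^+ b -> a != b -> torsion x.
Proof.
wlog ab : a b / a <= b => [hw e ne|e ne].
  have [/hw|/ltnW/hw] := leqP a b; first exact.
  by apply; [exact: esym|rewrite eq_sym].
exists (b - a); first by rewrite subn_gt0 ltn_neqAle ne.
by rewrite expgnFr// e mulgV.
Qed.

(** The descending chain of the [cyc (x ^+ (2 ^ n))] stops, so [x ^+ (2 ^ N)] is an integral power
    of [w]. This equates two powers of [x] whose exponents are an odd and an even multiple of
    [2 ^ N], hence distinct. *)
Lemma all_torsion x : torsion x.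
Proof.
have le n : sg_le (cyc (x ^+ (2 ^ n.+1)%N)) (cyc (x ^+ (2 ^ n)%N)).
  by apply: cyc_le; rewrite expnSr expgnA; exact: cycX.
have [N hN] := dcc le.
pose w := x ^+ (2 ^ N.+1)%N.
(* Integral powers of [w] appear as quotients of natural powers, as [w] is not yet known to be
   torsion. *)
have hS : is_subgroup ( *%g : G -> G -> G) 1 (fun x => x^-1)
    (fun y => exists i j, y * w ^+ i = w ^+ j).
  split; first by exists 0, 0; rewrite mul1g.
  split=> [y z [a [b e]] [c [d e']]|y [a [b e]]].
    exists (a + c), (b + d).
    rewrite [(a + c)%N]addnC expgnDr mulgA -(mulgA y) e' -mulgA.
    by rewrite -expgnDr addnC expgnDr mulgA e -expgnDr.
  by exists b, a; rewrite -e mulKg.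
have : cyc w ! (x ^+ (2 ^ N)%N) by rewrite /w hN.
move=> /(_ (exist _ _ hS)) /= []; first by exists 0%N, 1%N; rewrite expg0 mulg1 expg1.
move=> i [j]; rewrite /w -!expgnA -expgnDr => /torsion_eq; apply.
rewrite expnSr -!mulnA -mulnS eqn_mul2l negb_or -lt0n expn_gt0 /=.
by apply/eqP => /(congr1 odd) /=; rewrite !oddM.
Qed.
End Chains.
End Subgroups.

(** * Two nonplanar configurations of subgroups *)

Definition triple (T : Type) (a b c : T) (i : 'I_3) : T :=
  match val i with 0 => a | 1 => b | _ => c end.

(** As a vertex has at most one label, disjointness of walks reduces to disjointness of explicit
    label lists, which is decided by computation. One label may stand for many vertices. *)
Lemma labelled_no_K33 (V : Type) (adj : V -> V -> Prop) (L : eqType)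
    (lab : V -> L -> Prop) (a b : 'I_3 -> V) (w : 'I_3 -> 'I_3 -> seq V)
    (l : 'I_3 -> 'I_3 -> seq L) : planar_graph adj ->
  (forall v t t', lab v t -> lab v t' -> t = t') ->
  (forall i k, walk adj (a i) (w i k) /\ last (a i) (w i k) = b k) ->
  (forall i k v, List.In v (a i :: w i k) -> exists2 t, t \in l i k & lab v t) ->
  (forall i j k m, i != j -> k != m -> ~~ has (mem (l i k)) (l j m)) -> False.
Proof.
move=> pl labI hw hl disj; apply: (planar_no_K33 pl hw) => i j k m v ij km.
move=> /hl[t ti vt] /hl[t' tj vt'].
by have /hasPn/(_ _ tj)/negP := disj _ _ _ _ ij km; apply; rewrite -(labI _ _ _ vt vt').
Qed.

Lemma In_map (L : eqType) (V : Type) (f : L -> V) (s : seq L) v :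
  List.In v (map f s) -> exists2 t, t \in s & v = f t.
Proof.
elim: s => [|t s IH] //= [<-|/IH[t' t's ->]].
  by exists t => //; rewrite mem_head.
by exists t' => //; rewrite inE t's orbT.
Qed.

Lemma In_cat (V : Type) (s t : seq V) v :
  List.In v (s ++ t) -> List.In v s \/ List.In v t.
Proof. exact: (List.in_app_iff s t v).1. Qed.

Lemma walk_rev (V : Type) (adj : V -> V -> Prop) u s : (forall v w, adj v w -> adj w v) ->
  walk adj u s -> exists s', [/\ walk adj (last u s) s', last (last u s) s' = u &
    forall v, List.In v (last u s :: s') -> List.In v (u :: s)].
Proof.
move=> sym; elim: s u => [|v s IH] u; first by exists [::].
move=> [uv /IH[s' [ws' ls' hs']]]; exists (s' ++ [:: u]); split.
- apply: walk_cat => //; rewrite ls' /=; split=> //; exact: sym.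
- by rewrite last_cat.
- move=> z /(@In_cat _ (last v s :: s') [:: u])[zs|[<-|[]]]; last by left.
  by right; exact: hs'.
Qed.

(** * Subgroups of a cyclic group, with exponents of [p], [q], [r] as coordinates *)

Section Monomials.
Variables p q r : nat.
Hypotheses (pp : prime p) (pq : prime q) (pr : prime r).
Hypotheses (npq : p != q) (nqr : q != r) (npr : p != r).

Definition mon i j k := p ^ i * q ^ j * r ^ k.

Lemma mon_gt0 i j k : 0 < mon i j k.
Proof. by rewrite !muln_gt0 !expn_gt0 !prime_gt0. Qed.

Lemma logn_mon i j k : (logn p (mon i j k) = i) * (logn q (mon i j k) = j) *
  (logn r (mon i j k) = k).
Proof.
rewrite /mon !lognM ?muln_gt0 ?expn_gt0 ?prime_gt0// !lognX !logn_prime// !eqxx.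
rewrite (eq_sym q p) (eq_sym r p) (eq_sym r q) (negPf npq) (negPf nqr) (negPf npr).
by rewrite !muln0 !muln1 !addn0 !add0n.
Qed.

Lemma mon_dvd i j k i' j' k' :
  (mon i j k %| mon i' j' k') = [&& i <= i', j <= j' & k <= k'].
Proof.
apply/idP/and3P => [d|[? ? ?]]; last by rewrite /mon !dvdn_mul ?dvdn_exp2l.
have le := dvdn_leq_log _ (mon_gt0 i' j' k') d.
by have := (le p, le q, le r); rewrite !logn_mon => -[[]].
Qed.

Lemma monSl i j k : mon i.+1 j k = mon i j k * p.
Proof. by rewrite /mon expnSr -!mulnA (mulnC p) -!mulnA. Qed.
Lemma monSm i j k : mon i j.+1 k = mon i j k * q.
Proof. by rewrite /mon expnSr -!mulnA (mulnC q). Qed.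
Lemma monSr i j k : mon i j k.+1 = mon i j k * r.
Proof. by rewrite /mon expnSr mulnA. Qed.

Local Open Scope group_scope.
Variable G : groupType.
Notation sub := (subgrp ( *%g : G -> G -> G) 1 (fun x => x^-1)).
Notation "H ! x" := (proj1_sig H x) (at level 20).
Notation adj := (@subgroup_graph_adj G *%g 1 (fun x => x^-1)).
Implicit Types (H K L : sub) (x y z u v : G).

(** Larger coordinates give smaller subgroups, and raising one coordinate by 1 is an edge of the
    graph as long as the order of [x] allows it. *)
Definition pcyc x i j k := cyc (x ^+ mon i j k).

Section Steps.
Variables (x : G) (a b c : nat).
Hypotheses (tx : torsion x) (ox : order_mult (mon a b c) x).

Lemma pcyc_adjl i j k : i < a -> j <= b -> k <= c ->
  adj (pcyc x i j k) (pcyc x i.+1 j k) /\ adj (pcyc x i.+1 j k) (pcyc x i j k).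
Proof.
move=> ia jb kc; rewrite /pcyc monSl; apply: (cyc_adj tx ox) => //.
  by rewrite -monSl mon_dvd ia jb.
exact: mon_gt0.
Qed.

Lemma pcyc_adjm i j k : i <= a -> j < b -> k <= c ->
  adj (pcyc x i j k) (pcyc x i j.+1 k) /\ adj (pcyc x i j.+1 k) (pcyc x i j k).
Proof.
move=> ia jb kc; rewrite /pcyc monSm; apply: (cyc_adj tx ox) => //.
  by rewrite -monSm mon_dvd ia jb.
exact: mon_gt0.
Qed.

Lemma pcyc_adjr i j k : i <= a -> j <= b -> k < c ->
  adj (pcyc x i j k) (pcyc x i j k.+1) /\ adj (pcyc x i j k.+1) (pcyc x i j k).
Proof.
move=> ia jb kc; rewrite /pcyc monSr; apply: (cyc_adj tx ox) => //.
  by rewrite -monSr mon_dvd ia jb.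
exact: mon_gt0.
Qed.

Lemma pcyc_le i j k i' j' k' : i' <= a -> j' <= b -> k' <= c ->
  pcyc x i' j' k' ! (x ^+ mon i j k) -> [&& i' <= i, j' <= j & k' <= k].
Proof.
by move=> ia jb kc; rewrite -mon_dvd; apply: (cycX_dvd tx ox); rewrite mon_dvd ia jb.
Qed.

Lemma pcyc_inj i j k i' j' k' :
  [&& i <= a, j <= b & k <= c] -> [&& i' <= a, j' <= b & k' <= c] ->
  pcyc x i j k = pcyc x i' j' k' -> (i, j, k) = (i', j', k').
Proof.
move=> /and3P[ia jb kc] /and3P[ia' jb' kc'] e.
have : pcyc x i' j' k' ! (x ^+ mon i j k) by rewrite -e; exact: mem_cyc.
have : pcyc x i j k ! (x ^+ mon i' j' k') by rewrite e; exact: mem_cyc.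
move=> /pcyc_le-/(_ ia jb kc)/and3P[h1 h2 h3] /pcyc_le-/(_ ia' jb' kc')/and3P[h4 h5 h6].
congr (_, _, _); apply/eqP; rewrite eqn_leq ?h1 ?h2 ?h3 ?h4 ?h5 ?h6 //.
Qed.
End Steps.

Hypothesis planar : planar_graph adj.

Section Cube.
Hypothesis acc : subgroup_ACC ( *%g : G -> G -> G) 1 (fun x => x^-1).
Hypothesis dcc : subgroup_DCC ( *%g : G -> G -> G) 1 (fun x => x^-1).

Lemma whole_subgroup : is_subgroup ( *%g : G -> G -> G) 1 (fun x => x^-1) (fun=> True).
Proof. by []. Qed.

Local Open Scope nat_scope.
(* If y is outside <x>, going from 1 to <y>, up to G and down to <x> joins the bottom and the
   top of the cube of subgroups of <x> through subgroups outside the cube; a cube with an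
   additional path between antipodal vertices contains a subdivided K_{3,3}. *)
Lemma prime_order_in_cyc x y s : x ^+ mon 1 1 1 = 1%g -> order_mult (mon 1 1 1) x ->
  prime s -> y ^+ s = 1%g -> y <> 1%g -> cyc x ! y.
Proof.
move=> x1 ox ps ys y1; apply: contrapT => nxy.
pose W : sub := exist _ _ whole_subgroup.
have [sy [wy ly hy]] := @sub_walk G acc dcc (cyc y) W (fun _ _ => I).
have [sx [wx lx hx]] := @sub_walk G acc dcc (cyc x) W (fun _ _ => I).
have [t [wt lt ht]] : exists t, [/\ walk adj W t, last W t = cyc x &
    forall L, List.In L t -> sg_le (cyc x) L].
  have [|t [wt lt ht]] := walk_rev _ wx; first by move=> ? ? []; [right|left].
  by rewrite lx in wt lt ht; exists t; split=> // L Lt; apply/hx/ht; right.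
have tx : torsion x by exists (mon 1 1 1); [exact: mon_gt0|].
pose f (o : option (nat * nat * nat)) := if o is Some (i, j, k) then pcyc x i j k else W.
pose ok (o : option (nat * nat * nat)) :=
  if o is Some (i, j, k) then [&& i <= 1, j <= 1 & k <= 1] else true.
(* The label None stands for all subgroups not contained in <x>. *)
pose lab H o := if o is None then ~ sg_le H (cyc x) else H = f o /\ ok o.
have f000 : pcyc x 0 0 0 = cyc x by rewrite /pcyc expg1.
have f111 : pcyc x 1 1 1 = cyc 1%g by rewrite /pcyc x1.
have fx o : o != None -> sg_le (f o) (cyc x).
  by case: o => // -[[i j] k] _; apply: cyc_le; exact: cycX.
pose S i j k := Some (i, j, k) : option (nat * nat * nat).
(* In coordinates, the branch vertices are 111, 001, 010 against 000, 011, 101, where 111 is the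
   trivial subgroup and 000 is <x>. Seven of the nine paths are edges of the cube; 010 reaches 101
   through 110 and 100, and 111 reaches 000 outside the cube. *)
pose l := triple (triple [:: S 1 1 1; None; S 0 0 0] [:: S 0 1 1] [:: S 1 0 1])
  (triple [:: S 0 0 0] [:: S 0 1 1] [:: S 1 0 1])
  (triple [:: S 0 0 0] [:: S 0 1 1] [:: S 1 1 0; S 1 0 0; S 1 0 1]).
pose a := triple (S 1 1 1) (S 0 0 1) (S 0 1 0).
pose b := triple (S 0 0 0) (S 0 1 1) (S 1 0 1).
pose w i k := if (val i == 0) && (val k == 0) then cyc y :: sy ++ t else map f (l i k).
apply: (@labelled_no_K33 _ _ _ lab (f \o a) (f \o b) w (fun i k => a i :: l i k) planar).
- move=> H [[[i j] k]|] [[[i' j'] k']|] //=.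
  + by move=> [-> ok1] [e ok2]; have := pcyc_inj tx ox ok1 ok2 e => ->.
  + by move=> [-> _] []; exact: (fx (S i j k)).
  + by move=> h [e _]; case: h; rewrite e; exact: (fx (S i' j' k')).
- have L i j k := pcyc_adjl tx ox (i:=i) (j:=j) (k:=k).
  have M i j k := pcyc_adjm tx ox (i:=i) (j:=j) (k:=k).
  have N i j k := pcyc_adjr tx ox (i:=i) (j:=j) (k:=k).
  case=> [[|[|[|//]]] hi] [[|[|[|//]]] hk]; rewrite /w /comp /b /a /l /triple /=.
  + rewrite last_cat ly lt f000 f111; split=> //; split.
      (* The trivial subgroup is [cyc (y ^+ s)], hence maximal in [cyc y]. *)
      left; have := @cyc_maximal G y s _ ps; rewrite ys; apply; first by exists s => //; exact: prime_gt0.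
      by move=> h; apply: y1; have [|n ->] := cycP _ h; [exists 1%N; rewrite ?expg1|rewrite expg1n].
    by apply: walk_cat => //; rewrite ly.
  + by split=> //; split=> //; exact: (L 0 1 1 _ _ _).2.
  + by split=> //; split=> //; exact: (M 1 0 1 _ _ _).2.
  + by split=> //; split=> //; exact: (N 0 0 0 _ _ _).2.
  + by split=> //; split=> //; exact: (M 0 0 1 _ _ _).1.
  + by split=> //; split=> //; exact: (L 0 0 1 _ _ _).1.
  + by split=> //; split=> //; exact: (M 0 0 0 _ _ _).2.
  + by split=> //; split=> //; exact: (N 0 1 0 _ _ _).1.
  + split=> //; split; first exact: (L 0 1 0 _ _ _).1.
    split; first exact: (M 1 0 0 _ _ _).2.
    by split=> //; exact: (N 1 0 0 _ _ _).1.
- move=> i k v.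
  have gen : w i k = map f (l i k) -> all ok (a i :: l i k) -> None \notin a i :: l i k ->
      List.In v ((f \o a) i :: w i k) -> exists2 t, t \in a i :: l i k & lab v t.
    move=> -> /allP oks nn /(@In_map _ _ f (a i :: l i k))[c c1 ->]; exists c => //.
    by case: c c1 => [c|] c1; [split=> //; exact: oks|rewrite c1 in nn].
  have [/andP[/eqP i0 /eqP k0]|n00] := boolP ((val i == 0) && (val k == 0)); last first.
    apply: gen; first by rewrite /w (negPf n00).
    + by case: i k n00 => [[|[|[|//]]] hi] [[|[|[|//]]] hk].
    + by case: i k n00 => [[|[|[|//]]] hi] [[|[|[|//]]] hk].
  rewrite /w i0 k0 /= /l /a /triple i0 k0 /=.
  case=> [<-|]; first by exists (S 1 1 1) => //; split.
  have up L : sg_le (cyc y) L -> exists2 o, o \in [:: S 1 1 1; S 1 1 1; None; S 0 0 0] & lab L o.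
    by move=> yL; exists None => //= h; apply: nxy; apply/h/yL/mem_cyc.
  case=> [<-|/(@In_cat _ sy t)[vy|/ht xv]]; [exact: up|by apply/up/hy; right|].
  (* On the way down from [W] all subgroups contain <x>, so such a one is <x> itself or is not
     inside <x>. *)
  have [vx|nvx] := pselect (sg_le v (cyc x)); last by exists None.
  by exists (S 0 0 0) => //=; split=> //; rewrite -f000 in xv vx; exact: sub_ext.
- by case=> [[|[|[|//]]] ?] [[|[|[|//]]] ?] [[|[|[|//]]] ?] [[|[|[|//]]] ?].
Qed.
End Cube.

Local Open Scope nat_scope.

Lemma cyc_pow u v m : torsion u -> cyc u ! v -> cyc (u ^+ m) ! (v ^+ m).
Proof. by move=> tu /(cycP tu)[n ->]; rewrite expgnAC; exact: cycX. Qed.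

(* The subgroups generated by z1^(p^2 r), z1^r, z2^r on one side and by z1^(pqr), z1^(pr), z1^p
   on the other are the branch vertices of a subdivided K_{3,3}. *)
Lemma no_two_covers z1 z2 : torsion z1 -> torsion z2 ->
  order_mult (mon 2 1 1) z1 -> order_mult (mon 2 1 1) z2 ->
  cyc (z2 ^+ p) ! (z1 ^+ p) -> cyc (z1 ^+ p) ! (z2 ^+ p) ->
  ~ cyc z2 ! (z1 ^+ mon 0 1 1) -> False.
Proof.
move=> t1 t2 o1 o2 h12 h21 nz.
have mon1E u j k : u ^+ mon 1 j k = u ^+ p ^+ mon 0 j k.
  by rewrite monSl mulnC expgnA.
have eqz j k : pcyc z2 1 j k = pcyc z1 1 j k.
  rewrite /pcyc !mon1E; apply: sub_ext; apply: cyc_le.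
    by apply: cyc_pow => //; exact: torsionX.
  by apply: cyc_pow => //; exact: torsionX.
pose f (o : bool * (nat * nat * nat)) :=
  let: (c, (i, j, k)) := o in pcyc (if c then z1 else z2) i j k.
(* By [eqz] the subgroups with first coordinate 1 are common to [z1] and [z2]; they are labelled
   through [z1], and [false] is kept for first coordinate 0. *)
pose ok (o : bool * (nat * nat * nat)) :=
  let: (c, (i, j, k)) := o in [&& i <= 2, j <= 1 & k <= 1] && (c || (i == 0)).
pose lab H o := H = f o /\ ok o.
(* If [i = 0], equality would put [z1 ^+ mon 0 1 1] into [cyc z2]. If [i > 0], it would put a power
   of [z2] with exponent prime to [p] into [cyc (z2 ^+ p)], although [p] divides the order of
   [z2]. *)
have apart i j k j' k' : [&& i <= 2, j <= 1 & k <= 1] -> [&& 0 <= 2, j' <= 1 & k' <= 1] ->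
    pcyc z1 i j k <> pcyc z2 0 j' k'.
  move=> /and3P[i2 j1 k1] /and3P[_ j'1 k'1] e.
  case: (posnP i) => i0.
    have : pcyc z1 i j k ! (z1 ^+ mon 0 1 1).
      by apply: cycX_mem; rewrite mon_dvd i0 j1.
    by rewrite e => h; apply: nz; apply: (cyc_trans h); exact: cycX.
  have : pcyc z2 1 0 0 ! (z2 ^+ mon 0 j' k').
    rewrite eqz; have : pcyc z1 i j k ! (z2 ^+ mon 0 j' k') by rewrite e; exact: mem_cyc.
    move=> /cyc_trans; apply.
    by apply: cycX_mem; rewrite mon_dvd i0.
  by move=> h; have := @pcyc_le z2 2 1 1 t2 o2 0 j' k' 1 0 0 isT isT isT h.
pose S c i j k : bool * (nat * nat * nat) := (c, (i, j, k)).
(* The paths to 101 are single edges. Each other path has one inner vertex, reached from [a i] by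
   raising the [q]-coordinate or lowering the [r]-coordinate. *)
pose l := triple
  (triple [:: S true 2 1 1; S true 1 1 1] [:: S true 1 0 1] [:: S true 2 0 0; S true 1 0 0])
  (triple [:: S true 0 1 1; S true 1 1 1] [:: S true 1 0 1] [:: S true 0 0 0; S true 1 0 0])
  (triple [:: S false 0 1 1; S true 1 1 1] [:: S true 1 0 1] [:: S false 0 0 0; S true 1 0 0]).
pose a := triple (S true 2 0 1) (S true 0 0 1) (S false 0 0 1).
pose b := triple (S true 1 1 1) (S true 1 0 1) (S true 1 0 0).
apply: (@labelled_no_K33 _ _ _ lab (f \o a) (f \o b) (fun i k => map f (l i k))
  (fun i k => a i :: l i k) planar).
- move=> H [c [[i j] k]] [c' [[i' j'] k']] [-> /andP[ok1 h1]] [+ /andP[ok2 h2]] => /=.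
  case: c c' h1 h2 => [] [] //= => [_ _|_ /eqP i0|/eqP i0 _|_ _].
  + by move=> /(pcyc_inj t1 o1 ok1 ok2) ->.
  + by rewrite i0 in ok2 * => /(apart _ _ _ _ _ ok1 ok2).
  + by rewrite i0 in ok1 * => /esym/(apart _ _ _ _ _ ok2 ok1).
  + by move=> /(pcyc_inj t2 o2 ok1 ok2) ->.
- have L i j k := pcyc_adjl t1 o1 (i:=i) (j:=j) (k:=k).
  have M i j k := pcyc_adjm t1 o1 (i:=i) (j:=j) (k:=k).
  have N i j k := pcyc_adjr t1 o1 (i:=i) (j:=j) (k:=k).
  have L' i j k := pcyc_adjl t2 o2 (i:=i) (j:=j) (k:=k).
  have M' i j k := pcyc_adjm t2 o2 (i:=i) (j:=j) (k:=k).
  have N' i j k := pcyc_adjr t2 o2 (i:=i) (j:=j) (k:=k).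
  case=> [[|[|[|//]]] hi] [[|[|[|//]]] hk]; rewrite /comp /b /a /l /triple /=.
  + by do 2!split=> //; [exact: (M 2 0 1 _ _ _).1|split=> //; exact: (L 1 1 1 _ _ _).2].
  + by do 2!split=> //; exact: (L 1 0 1 _ _ _).2.
  + by do 2!split=> //; [exact: (N 2 0 0 _ _ _).2|split=> //; exact: (L 1 0 0 _ _ _).2].
  + by do 2!split=> //; [exact: (M 0 0 1 _ _ _).1|split=> //; exact: (L 0 1 1 _ _ _).1].
  + by do 2!split=> //; exact: (L 0 0 1 _ _ _).1.
  + by do 2!split=> //; [exact: (N 0 0 0 _ _ _).2|split=> //; exact: (L 0 0 0 _ _ _).1].
  + rewrite -!eqz.
    by do 2!split=> //; [exact: (M' 0 0 1 _ _ _).1|split=> //; exact: (L' 0 1 1 _ _ _).1].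
  + by rewrite -!eqz; do 2!split=> //; exact: (L' 0 0 1 _ _ _).1.
  + rewrite -!eqz.
    by do 2!split=> //; [exact: (N' 0 0 0 _ _ _).2|split=> //; exact: (L' 0 0 0 _ _ _).1].
- move=> i k v /(@In_map _ _ f (a i :: l i k))[c ci ->]; exists c => //; split=> //.
  apply: (allP _ _ ci).
  by case: i k {ci} => [[|[|[|//]]] hi] [[|[|[|//]]] hk].
- by case=> [[|[|[|//]]] ?] [[|[|[|//]]] ?] [[|[|[|//]]] ?] [[|[|[|//]]] ?].
Qed.
End Monomials.

(** * Primary elements commuting with x *)

Section PrimaryElements.
Variable G : groupType.
Notation sub := (subgrp ( *%g : G -> G -> G) 1%g (fun x => x^-1%g)).
Notation "H ! x" := (proj1_sig H x) (at level 20).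
Notation adj := (@subgroup_graph_adj G *%g 1%g (fun x => x^-1%g)).
Implicit Types (H K L : sub) (x y z u v g h : G).
Local Open Scope group_scope.
Local Open Scope nat_scope.

Lemma cyc1 u : cyc (1%g : G) ! u -> u = 1%g.
Proof.
by move=> h; have [|n ->] := cycP _ h; [exists 1; rewrite ?expg1|rewrite expg1n].
Qed.

Lemma expg_eq1_coprime u m n : coprime m n -> u ^+ m = 1%g -> u ^+ n = 1%g -> u = 1%g.
Proof. by move=> mn um un; apply/cyc1/(sub_coprime mn); rewrite ?um ?un; exact: mem_cyc. Qed.

Lemma sub_pexp H p u n m : coprime m (p ^ n) -> u ^+ (p ^ n) = 1%g -> H ! (u ^+ m) -> H ! u.
Proof. by move=> mp un um; apply: (sub_coprime mp) => //; rewrite un; exact: sub1. Qed.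

(** The elements [w ^+ k] and [w ^+ (p ^ logn p k)] generate the same subgroup, so the valuations of
    the exponents decide. The first case has the strictly larger valuation for [u], whence
    [v ^+ p]. *)
Lemma cyc_pgroup_chain p w n u v : prime p -> w ^+ (p ^ n) = 1%g -> cyc w ! u -> cyc w ! v ->
  cyc (v ^+ p) ! u \/ cyc u ! v.
Proof.
move=> pp wn.
have tw : torsion w by exists (p ^ n) => //; rewrite expn_gt0 prime_gt0.
move=> /(cycP tw)[i ->] /(cycP tw)[j ->].
case: (posnP i) => [->|i0]; first by left; rewrite expg0; exact: sub1.
case: (posnP j) => [->|j0]; first by right; rewrite expg0; exact: sub1.
have key k : 0 < k -> cyc (w ^+ k) ! (w ^+ (p ^ logn p k)).
  move=> k0; have [m pm km] := pfactor_coprime pp k0.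
  apply: (@sub_pexp _ p _ n m); first by rewrite coprime_sym coprimeXl.
    by rewrite expgnAC wn expg1n.
  by rewrite -expgnA mulnC -km; exact: mem_cyc.
have [h|h] := leqP (logn p i) (logn p j); [right|left].
  apply: cyc_trans (key i i0); apply: cycX_mem.
  by apply: dvdn_trans (pfactor_dvdnn p j); exact: dvdn_exp2l.
apply: (@cyc_trans _ _ (w ^+ (p ^ logn p j) ^+ p)).
  rewrite -expgnA -expnSr; apply: cycX_mem.
  by apply: dvdn_trans (pfactor_dvdnn p i); exact: dvdn_exp2l.
by apply: cyc_pow; [exact: torsionX|exact: key].
Qed.

(** Repeated [p]-th powers of [a] end at 1, which lies in [H]; [c] is the last one outside. *)
Lemma first_outside H p a m : a ^+ (p ^ m) = 1%g -> ~ H ! a ->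
  exists c, [/\ cyc a ! c, ~ H ! c & H ! (c ^+ p)].
Proof.
elim: m a => [|m IH] a am na; first by case: na; move: am; rewrite expn0 expg1 => ->; exact: sub1.
have [h|h] := pselect (H ! (a ^+ p)); first by exists a; split.
have [|c [ca nc cp]] := IH (a ^+ p) _ h; first by rewrite -expgnA -expnS.
by exists c; split=> //; apply: (cyc_trans ca); exact: cycX.
Qed.

Lemma coprime_factors b y m n : commute b y -> coprime m n ->
  b ^+ m = 1%g -> y ^+ n = 1%g -> cyc (b * y)%g ! b /\ cyc (b * y)%g ! y.
Proof.
move=> by_ mn bm yn; have := @cycX G (b * y)%g n; have := @cycX G (b * y)%g m.
rewrite !expgMn// bm yn mulg1 mul1g => hy hb.
split; first by apply: (sub_coprime mn) => //; rewrite bm; exact: sub1.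
by apply: (sub_coprime mn) => //; rewrite yn; exact: sub1.
Qed.

Lemma coprime_split g m n : 0 < m -> coprime m n -> g ^+ (m * n) = 1%g ->
  exists u v, [/\ g = (u * v)%g, cyc g ! u, cyc g ! v, u ^+ n = 1%g & v ^+ m = 1%g].
Proof.
move=> m0 /eqP; case: (egcdnP n m0) => km kn e _ mn gmn.
exists (g ^+ (km * m)), (g ^+ (kn * n))^-1%g; split.
- by rewrite e mn addnC expgnDr expg1 mulgK.
- exact: cycX.
- by apply: subV; exact: cycX.
- by rewrite -expgnA -mulnA mulnC expgnA gmn expg1n.
- by rewrite expVgn -expgnA -mulnA (mulnC n) mulnC expgnA gmn expg1n invg1.
Qed.

Section CommutingPrimary.
Variables p q r : nat.
Hypotheses (pp : prime p) (pq : prime q) (pr : prime r).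
Hypotheses (npq : p != q) (nqr : q != r) (npr : p != r).
Hypothesis planar : planar_graph adj.
Hypothesis acc : subgroup_ACC ( *%g : G -> G -> G) 1%g (fun x => x^-1%g).
Hypothesis dcc : subgroup_DCC ( *%g : G -> G -> G) 1%g (fun x => x^-1%g).
Variable x : G.
Hypotheses (x1 : x ^+ (p * q * r) = 1%g) (ox : order_mult (p * q * r) x).
Hypothesis prime_in : forall y s, prime s -> y ^+ s = 1%g -> y <> 1%g -> cyc x ! y.

Let tor := all_torsion dcc.

Lemma coprime_p_qr : coprime p (q * r).
Proof. by rewrite coprimeMr !prime_coprime// !dvdn_prime2// npq. Qed.

Lemma torsion_p_in u : cyc x ! u -> u ^+ p = 1%g -> cyc (x ^+ (q * r)) ! u.
Proof.
move=> /(cycP (tor x))[k ->]; rewrite -expgnA => /ox.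
by rewrite -mulnA mulnC dvdn_pmul2r ?prime_gt0// => d; exact: cycX_mem.
Qed.

(** In a relation for the product, raising to the power [p ^ m] removes [a] and shows [q * r %| n];
    raising to the power [q * r] removes [x ^+ p] and leaves [a], whose order is divisible by
    [p ^ 2]. *)
Lemma order_mult_mul a m : commute a x -> a ^+ (p ^ m) = 1%g -> a ^+ p <> 1%g ->
  order_mult (mon p q r 2 1 1) (a * x ^+ p)%g.
Proof.
move=> ax am ap n; rewrite expgMn; last exact: commuteX.
move=> e.
have d1 : q * r %| n.
  have : x ^+ (p * n * p ^ m) = 1%g.
    have /(congr1 (fun u => u ^+ (p ^ m))) := e.
    rewrite expg1n expgMn; last by apply: commuteX2; exact: commuteX.
    by rewrite -expgnA (mulnC n) expgnA am expg1n mul1g !expgnA.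
  move/ox; rewrite -!mulnA dvdn_pmul2l ?prime_gt0// Gauss_dvdl//.
  by rewrite coprime_sym coprimeXl// coprime_p_qr.
have an : a ^+ (n * (q * r)) = 1%g.
  have /(congr1 (fun u => u ^+ (q * r))) := e.
  rewrite expg1n expgMn; last by apply: commuteX2; exact: commuteX.
  have -> : x ^+ p ^+ n ^+ (q * r) = 1%g.
    by rewrite -!expgnA (mulnC n) !mulnA expgnA x1 expg1n.
  by rewrite mulg1 -expgnA.
have d2 : p ^ 2 %| n.
  case: (posnP n) => [->//|n0]; rewrite pfactor_dvdn//.
  rewrite leqNgt; apply/negP => l1; apply: ap.
  have [k pk nk] := pfactor_coprime pp n0.
  suff ak : a ^+ (p ^ logn p n) = 1%g.
    by move: l1 ak; case: (logn p n) => [|[|//]] _; rewrite ?expg1 // => ->; rewrite expg1n.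
  apply: (@expg_eq1_coprime _ (k * (q * r)) (p ^ m)).
  - by rewrite coprime_sym coprimeXl// coprimeMr pk coprime_p_qr.
  - by rewrite -expgnA mulnA (mulnC _ k) -nk.
  - by rewrite expgnAC am expg1n.
rewrite /mon !expn1 -mulnA Gauss_dvd; first by rewrite d2.
by rewrite coprimeXl// coprime_p_qr.
Qed.

Lemma commuting_p_chain a b m n : commute a x -> commute b x ->
  a ^+ (p ^ m) = 1%g -> b ^+ (p ^ n) = 1%g -> cyc b ! a \/ cyc a ! b.
Proof.
move=> ax bx am bn; apply: contrapT => /not_orP[na nb].
(* The pair is shrunk to incomparable [a1], [b1] whose [p]-th powers lie in <b> and <a1>; these
   powers then generate the same subgroup. *)
have [a1 [aa1 na1 a1p]] := first_outside am na.
have nb1 : ~ cyc a1 ! b by move=> h; apply: nb; exact: cyc_trans h aa1.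
have [b1 [bb1 {}nb1 b1p]] := first_outside bn nb1.
have {}na1 : ~ cyc b1 ! a1 by move=> h; apply: na1; exact: cyc_trans h bb1.
have cX c c' l : cyc c ! c' -> commute c x -> c ^+ (p ^ l) = 1%g ->
    commute c' x /\ c' ^+ (p ^ l) = 1%g.
  move=> /(cycP (tor c))[i ->] cx cl; split; first exact/commute_sym/commuteX/commute_sym.
  by rewrite expgnAC cl expg1n.
have [a1x a1m] := cX _ _ _ aa1 ax am; have [b1x b1n] := cX _ _ _ bb1 bx bn.
have ab : cyc (b1 ^+ p) ! (a1 ^+ p).
  have [//|h] := cyc_pgroup_chain pp bn a1p bb1.
  by case: nb1; apply: (cyc_trans h); exact: cycX.
have ba : cyc (a1 ^+ p) ! (b1 ^+ p).
  have [//|h] := cyc_pgroup_chain pp am (cyc_trans b1p aa1) aa1.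
  by case: na1; apply: (cyc_trans h); exact: cycX.
have a1_neq1 : a1 <> 1%g by move=> h; apply: na1; rewrite h; exact: sub1.
have b1_neq1 : b1 <> 1%g by move=> h; apply: nb1; rewrite h; exact: sub1.
(* Otherwise [a1] and [b1] both have order [p] and lie in the subgroup of order [p] of <x>, where
   they are comparable. *)
have ap : a1 ^+ p <> 1%g.
  move=> ap1; have bp1 : b1 ^+ p = 1%g by apply: cyc1; move: ba; rewrite ap1.
  have ax1 := torsion_p_in (prime_in pp ap1 a1_neq1) ap1.
  have bx1 := torsion_p_in (prime_in pp bp1 b1_neq1) bp1.
  have ep : (x ^+ (q * r)) ^+ (p ^ 1) = 1%g by rewrite -expgnA mulnC mulnA x1.
  have [h|//] := cyc_pgroup_chain pp ep ax1 bx1.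
  by apply: na1; apply: (cyc_trans h); exact: cycX.
have bp : b1 ^+ p <> 1%g by move=> h; apply: ap; apply: cyc1; move: ab; rewrite h.
(* Multiplication by [y], of order [q * r], brings the primes [q] and [r] into the orders, as
   [no_two_covers] requires. *)
pose y := x ^+ p.
have yqr : y ^+ (q * r) = 1%g by rewrite /y -expgnA mulnA.
have [a1y b1y] : commute a1 y /\ commute b1 y by split; exact: commuteX.
have cop k : coprime (p ^ k) (q * r) by rewrite coprimeXl// coprime_p_qr.
have part c c' l : commute c y -> commute c' y -> c' ^+ (p ^ l) = 1%g ->
    cyc (c' ^+ p) ! (c ^+ p) -> cyc ((c' * y)%g ^+ p) ! ((c * y)%g ^+ p).
  move=> cy c'y c'l cc'; rewrite !expgMn//.
  have [h1 h2] : cyc (c' ^+ p * y ^+ p)%g ! (c' ^+ p) /\ cyc (c' ^+ p * y ^+ p)%g ! (y ^+ p).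
    apply: (coprime_factors _ (cop l)); first exact: commuteX2.
      by rewrite expgnAC c'l expg1n.
    by rewrite expgnAC yqr expg1n.
  by apply: subM => //; exact: cyc_trans cc' h1.
apply: (no_two_covers pp pq pr npq nqr npr planar (tor (a1 * y)%g) (tor (b1 * y)%g)).
- exact: order_mult_mul a1m ap.
- exact: order_mult_mul b1n bp.
- exact: part b1n ab.
- exact: part a1m ba.
rewrite /mon mul1n !expn1 => /(cycP (tor _))[k].
(* Raising to the power [q * r] once more removes [y] on the right, so a power of [a1] with exponent
   prime to [p] lies in <b1>, and hence [a1] does. *)
rewrite !expgMn// yqr mulg1 => /(congr1 (fun u => u ^+ (q * r))).
rewrite [RHS]expgMn; last exact: commuteX2.
rewrite (expgnAC y) yqr expg1n mulg1 => e; apply: na1.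
apply: (@sub_pexp _ p _ m (q * r * (q * r))) => //.
  by rewrite coprime_sym coprimeMr cop.
by rewrite expgnA e -expgnA; exact: cycX.
Qed.

(** A maximal cyclic subgroup generated by such an element exists by the ascending chain condition,
    and comparability makes it contain all the others. *)
Lemma commuting_p_cyclic :
  exists m, forall g k, commute g x -> g ^+ (p ^ k) = 1%g -> cyc m ! g.
Proof.
pose P H := exists m k, [/\ H = cyc m, commute m x & m ^+ (p ^ k) = 1%g].
have [|_ [m [k [-> mx mk]]] max] := @well_founded_min _ _ P (sg_gt_wf acc).
  exists (cyc 1%g), 1%g, 0; split=> //.
  exact/commute_sym/commute1.
exists m => g l gx gl; have [//|gm] := commuting_p_chain gx mx gl mk.
have [->|ne] := pselect (cyc m = cyc g); first exact: mem_cyc.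
by case: (max (cyc g)); [split=> //; exact: cyc_le|exists g, l].
Qed.
End CommutingPrimary.

(** * Finiteness of the centralizer of [x] and of [G] *)

Section Centralizer.
Variables p q r : nat.
Hypotheses (pp : prime p) (pq : prime q) (pr : prime r).
Hypotheses (npq : p != q) (nqr : q != r) (npr : p != r).
Hypothesis planar : planar_graph adj.
Hypothesis acc : subgroup_ACC ( *%g : G -> G -> G) 1%g (fun x => x^-1%g).
Hypothesis dcc : subgroup_DCC ( *%g : G -> G -> G) 1%g (fun x => x^-1%g).
Variable x : G.
Hypotheses (x1 : x ^+ (p * q * r) = 1%g) (ox : order_mult (p * q * r) x).
Hypothesis prime_in : forall y s, prime s -> y ^+ s = 1%g -> y <> 1%g -> cyc x ! y.

Let tor := all_torsion dcc.

(** For a prime [s] dividing [n], a nontrivial [h ^+ (n / s)] would have order [s] and lie in <x>,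
    whose order is prime to [s]. So [n] can be replaced by [n / s]. *)
Lemma coprime_order_trivial n h : 0 < n -> coprime n (p * q * r) -> h ^+ n = 1%g -> h = 1%g.
Proof.
have [k] := ubnP n; elim: k n h => // k IH n h nk n0 co hn.
have [n1|n1] := leqP n 1.
  by have e : n = 1 by [apply/eqP; rewrite eqn_leq n1]; move: hn; rewrite e expg1.
have ps := pdiv_prime n1; set s := pdiv n in ps.
have /dvdnP[m nm] : s %| n by exact: pdiv_dvd.
have m0 : 0 < m by move: n0; rewrite nm muln_gt0 => /andP[].
have [com cos] : coprime m (p * q * r) /\ coprime s (p * q * r).
  by move: co; rewrite nm coprimeMl => /andP.
apply: (IH m) => //; first by rewrite -ltnS (leq_trans _ nk)// ltnS nm ltn_Pmulr// prime_gt1.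
apply: contrapT => hm.
have hms : h ^+ m ^+ s = 1%g by rewrite -expgnA -nm.
have [j hj] := cycP (tor x) (prime_in ps hms hm).
apply: hm; rewrite hj; move: hms; rewrite hj -expgnA => /ox.
by rewrite Gauss_dvdl ?(coprime_sym _ s)// => /dvdnP[i ->]; rewrite mulnC expgnA x1 expg1n.
Qed.

Lemma pqr_order g : exists a b c, g ^+ (p ^ a * (q ^ b * r ^ c)) = 1%g.
Proof.
have [n n0 gn] := tor g.
have [n1 pn1 e1] := pfactor_coprime pp n0.
have n10 : 0 < n1 by move: n0; rewrite e1 muln_gt0 => /andP[].
have [n2 qn2 e2] := pfactor_coprime pq n10.
have n20 : 0 < n2 by move: n10; rewrite e2 muln_gt0 => /andP[].
have [n3 rn3 e3] := pfactor_coprime pr n20.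
have n30 : 0 < n3 by move: n20; rewrite e3 muln_gt0 => /andP[].
move: pn1 qn2 e1 e2 e3; set a := logn p n; set b := logn q n1; set c := logn r n2.
move=> pn1 qn2 e1 e2 e3; exists a, b, c.
apply: (@coprime_order_trivial n3) => //.
  move: pn1 qn2; rewrite e2 e3 !coprimeMr => /andP[/andP[pn3 _] _] /andP[qn3 _].
  by rewrite !(coprime_sym n3) pn3 qn3.
by rewrite -expgnA -[RHS]gn e1 e2 e3; congr (g ^+ _);
  rewrite mulnC (mulnC (p ^ a)) (mulnC (q ^ b)) !mulnA.
Qed.

Lemma cyc_finite m : exists s : seq G, forall u, cyc m ! u -> u \in s.
Proof.
have [n n0 mn] := tor m; exists [seq m ^+ i | i <- iota 0 n] => u /(cycP (tor m))[k ->].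
rewrite (divn_eq k n) expgnDr mulnC expgnA mn expg1n mul1g.
by apply/mapP; exists (k %% n) => //; rewrite mem_iota ltn_mod.
Qed.

Lemma centralizer_finite : exists s : seq G, forall g, commute g x -> g \in s.
Proof.
(* The product is reordered so that [commuting_p_cyclic] applies with [q] and then [r] in the place
   of [p]. *)
have E1 : p * q * r = q * p * r by rewrite (mulnC p).
have E2 : p * q * r = r * q * p by rewrite mulnC (mulnC p) mulnA.
have nqp : q != p by rewrite eq_sym.
have nrq : r != q by rewrite eq_sym.
have nrp : r != p by rewrite eq_sym.
have [mp hp] := commuting_p_cyclic pp pq pr npq nqr npr planar acc dcc x1 ox prime_in.
have [mq hq] : exists m, forall g k, commute g x -> g ^+ (q ^ k) = 1%g -> cyc m ! g.
  move: x1 ox; rewrite E1 => x1' ox'.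
  exact: (commuting_p_cyclic pq pp pr nqp npr nqr planar acc dcc x1' ox' prime_in).
have [mr hr] : exists m, forall g k, commute g x -> g ^+ (r ^ k) = 1%g -> cyc m ! g.
  move: x1 ox; rewrite E2 => x1' ox'.
  exact: (commuting_p_cyclic pr pq pp nrq nqp nrp planar acc dcc x1' ox' prime_in).
have [[sp hsp] [sq hsq] [sr hsr]] := And3 (cyc_finite mp) (cyc_finite mq) (cyc_finite mr).
exists [seq (u * v)%g | u <- [seq (u * v)%g | u <- sr, v <- sq], v <- sp] => g gx.
have comm u : cyc g ! u -> commute u x.
  by move=> /(cycP (tor g))[n ->]; exact/commute_sym/commuteX/commute_sym.
have [a [b [c gn]]] := pqr_order g.
have cop s t k l : prime s -> prime t -> s != t -> coprime (s ^ k) (t ^ l).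
  by move=> ps pt st; rewrite coprimeXl// coprimeXr// prime_coprime// dvdn_prime2.
have [||u [v [guv gu gv un vn]]] := coprime_split _ _ gn.
- by rewrite expn_gt0 prime_gt0.
- by rewrite coprimeMr !cop.
have [||u' [v' [uuv uu uv un' vn']]] := coprime_split _ _ un.
- by rewrite expn_gt0 prime_gt0.
- exact: cop.
rewrite guv uuv; apply: allpairs_f; first apply: allpairs_f.
- by apply: hsr; apply: hr un'; apply: comm; exact: cyc_trans uu gu.
- by apply: hsq; apply: hq vn'; apply: comm; exact: cyc_trans uv gu.
- by apply: hsp; apply: hp vn; exact: comm.
Qed.

(** The powers of [x ^ g] with exponents [q * r], [p * r] and [p * q] have prime order, so they lie
    in <x>; their exponents have no common factor. *)
Lemma conj_in_cyc g : cyc x ! (x ^ g)%g.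
Proof.
have key m s : prime s -> m * s = p * q * r -> cyc x ! ((x ^ g)%g ^+ m).
  move=> ps ms; rewrite -conjXg; apply: (prime_in ps).
    by rewrite -conjXg -expgnA ms x1 conj1g.
  have m0 : 0 < m.
    have : 0 < m * s by rewrite ms !muln_gt0 !prime_gt0.
    by rewrite muln_gt0 => /andP[].
  move=> /eqP; rewrite conjg_eq1 => /eqP /ox; rewrite -ms => /(dvdn_leq m0).
  by rewrite leqNgt ltn_Pmulr// prime_gt1.
have cop s t : prime s -> prime t -> s != t -> coprime s t.
  by move=> ps pt st; rewrite prime_coprime// dvdn_prime2.
have kr : cyc x ! ((x ^ g)%g ^+ r).
  apply: (@sub_coprime _ _ _ p q); first exact: cop.
    by rewrite -expgnA; apply: (key _ q pq); rewrite -mulnA mulnC.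
  by rewrite -expgnA; apply: (key _ p pp); rewrite -mulnA mulnC (mulnC q).
apply: (@sub_coprime _ _ _ (p * q) r) => //; first by rewrite coprimeMl !cop.
exact: (key _ r pr).
Qed.

(** Elements conjugating [x] to the same element differ by a factor from the centralizer, and the
    conjugates of [x] lie in the finite group <x>. *)
Lemma group_finite : exists s : seq G, forall g, g \in s.
Proof.
have [sc hc] := centralizer_finite; have [sx hx] := cyc_finite x.
(* [rep u] conjugates [x] to [u]; it may be 1 when [u] is not a conjugate of [x]. *)
have /choice[rep hrep] : forall u, exists h, forall g, (x ^ g)%g = u -> (x ^ h)%g = u.
  move=> u; have [[h hu]|nh] := pselect (exists h, (x ^ h)%g = u); first by exists h.
  by exists 1%g => g gu; case: nh; exists g.
exists [seq (c * rep u)%g | c <- sc, u <- sx] => g.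
rewrite -(mulgVK (rep (x ^ g)%g) g).
apply: allpairs_f; last exact/hx/conj_in_cyc.
apply: hc; set h := rep _.
have : (x ^ (g / h))%g = x by rewrite conjgM -(hrep (x ^ g)%g g erefl) conjgK.
by move=> /(congr1 (fun u => (g / h * u)%g)); rewrite conjgE mulVKg => /esym.
Qed.
End Centralizer.
End PrimaryElements.

(** * The result for a [groupType] and its transfer to the bare group axioms *)

Theorem planar_pqr_finite (G : groupType) (p q r : nat) (x : G) :
  prime p -> prime q -> prime r -> p != q -> q != r -> p != r ->
  planar_group ( *%g : G -> G -> G) 1%g (fun x => x^-1%g) ->
  subgroup_ACC ( *%g : G -> G -> G) 1%g (fun x => x^-1%g) ->
  subgroup_DCC ( *%g : G -> G -> G) 1%g (fun x => x^-1%g) ->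
  (x ^+ (p * q * r) = 1)%g -> order_mult (p * q * r) x ->
  exists s : seq G, forall g, g \in s.
Proof.
move=> pp pq pr npq nqr npr pl acc dcc x1 ox.
apply: (@group_finite G p q r pp pq pr npq nqr npr pl acc dcc x x1 ox) => y s ps ys y1.
apply: (@prime_order_in_cyc p q r pp pq pr npq nqr npr G pl acc dcc x y s) => //.
Qed.

Lemma mem_In (E : eqType) (s : seq E) y : y \in s -> List.In y s.
Proof. by elim: s => //= z s IH; rewrite inE => /predU1P[->|/IH]; [left|right]. Qed.

Lemma gpowE (G : groupType) (x : G) n : gpow *%g 1%g x n = (x ^+ n)%g.
Proof. by elim: n => //= n ->; rewrite expgS. Qed.

Lemma has_order_mult (G : groupType) (x : G) n :
  has_order *%g 1%g x n -> (x ^+ n = 1)%g /\ order_mult n x.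
Proof.
move=> [n0 []]; rewrite gpowE => xn min; split=> // m xm.
rewrite /dvdn eqn0Ngt; apply/negP => m0.
case: (min _ m0); first exact: ltn_pmod.
by rewrite gpowE; move: xm; rewrite {1}(divn_eq m n) expgnDr mulnC expgnA xn expg1n mul1g.
Qed.

Theorem theorem3p2 (T : Type) (mul : T -> T -> T) (one : T) (inv : T -> T) :
  is_group mul one inv ->
  infinite_type T ->
  planar_group mul one inv ->
  subgroup_ACC mul one inv ->
  subgroup_DCC mul one inv ->
  forall p q r : nat, prime p -> prime q -> prime r ->
    p <> q -> q <> r -> p <> r ->
    ~ exists x : T, has_order mul one x (p * q * r).
Proof.
move=> [mulA mul1 mulV] inf pl acc dcc p q r pp pq pr /eqP npq /eqP nqr /eqP npr [x ox].
(* The axioms are one-sided; the right inverse and right unit laws are derived for [groupType]. *)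
have mulV' y : mul y (inv y) = one.
  by rewrite -[LHS]mul1 -{1}(mulV (inv y)) -mulA (mulA (inv y)) mulV mul1 mulV.
have mul1' y : mul y one = y by rewrite -(mulV y) mulA mulV' mul1.
(* Classical axioms supply the decidable equality and the choice operator on [T] that a [groupType]
   carries. *)
pose C : choiceType := HB.pack T (gen_eqMixin T) (gen_choiceMixin T).
pose M := isGroup.Build C mulA mul1 mul1' mulV mulV'.
pose G : groupType := HB.pack T C M.
have [x1 om] := @has_order_mult G x _ ox.
have [s hs] := @planar_pqr_finite G p q r x pp pq pr npq nqr npr pl acc dcc x1 om.
apply: inf; exists s => y; exact: (@mem_In G s y (hs y)).
Qed.
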